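(* Let $n\ge 2$ and consider the arc-reversal walk on the complete graph $K_n$. The walk does not admit peak state transfer (between any pair of distinct vertices, at any time) for $n>2$, and there is no periodicity at any vertex for $n>3$. The graph $K_2$ admits perfect state transfer at time $1$ and is $2$-periodic at every vertex. The graph $K_3$ is $3$-periodic at every vertex.
   Context: Arc-reversal walk: let $G=(V,E)$ be a finite simple graph without isolated vertices and $\mathcal{A}$ its set of arcs (ordered pairs $(u,v)$ with $uv\in E$; $u$ is the tail). Let $N\in\mathbb{R}^{\mathcal{A}\times V}$ with $N(a,v)=1/\sqrt{d(v)}$ if $v$ is the tail of $a$ and $0$ otherwise ($d(v)$ is the degree), and let $R$ be the permutation matrix on $\mathcal{A}$ swapping $(u,v)$ and $(v,u)$. The transition matrix is $U=R(2NN^T-I)$. Put $B_t=N^TU^tN$ for integers $t\ge0$, and $B=B_1=D^{-1/2}AD^{-1/2}$, where $A$ is the adjacency matrix and $D$ the diagonal degree matrix. Let $B=\sum_\theta\theta E_\theta$ be the spectral decomposition ($\theta$ over distinct eigenvalues, $E_\theta$ the orthogonal projection onto the $\theta$-eigenspace). For distinct vertices $u,v$ there is peak state transfer from $u$ to $v$ at time $t$ (a positive integer) if $|B_t(u,v)|=\sum_\theta|E_\theta(u,v)|$ and $E_\theta(u,v)\neq0$ for at least one $\theta$. There is perfect state transfer from $u$ to $v\neq u$ at time $t$ if $U^tN\mathbf{e}_u=\gamma N\mathbf{e}_v$ for some $\gamma\in\mathbb{C}$ with $|\gamma|=1$ (equivalently $|B_t(u,v)|=1$). The walk is periodic at $u$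 if $U^tN\mathbf{e}_u=\gamma N\mathbf{e}_u$ for some integer $t>0$ and some $|\gamma|=1$; the smallest such $t$ is the period, and the walk is then called $t$-periodic at $u$. *)

(* Defs.v *)
From mathcomp Require Import all_boot all_order all_algebra.
From mathcomp Require Import boolp classical_sets cardinality fsbigop reals.
From mathcomp Require Import polyrcf complex.

Set Implicit Arguments.
Unset Strict Implicit.
Unset Printing Implicit Defensive.

Import Order.TTheory GRing.Theory Num.Theory.
Local Open Scope ring_scope.
Local Open Scope complex_scope.
Local Open Scope classical_set_scope.

Record sgraph (n : nat) := SGraph {
  adj :> rel 'I_n;
  adj_sym : symmetric adj;
  adj_irr : irreflexive adj
}.

Lemma complete_sym n : symmetric (fun u v : 'I_n => u != v).
Proof. by move=> u v; rewrite eq_sym. Qed.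

Lemma complete_irr n : irreflexive (fun u v : 'I_n => u != v).
Proof. by move=> u; rewrite eqxx. Qed.

Definition complete_graph (n : nat) : sgraph n :=
  SGraph (@complete_sym n) (@complete_irr n).

Definition deg n (g : sgraph n) (v : 'I_n) : nat := #|[set w | g v w]%SET|.

Definition no_isolated n (g : sgraph n) : Prop := forall v, (0 < deg g v)%N.

Lemma deg_complete n (v : 'I_n) : deg (complete_graph n) v = n.-1.
Proof.
by rewrite -[in RHS](card_ord n) /deg cardsE -(cardC1 v); apply: eq_card => w;
   rewrite !inE eq_sym.
Qed.

Lemma no_isolated_complete n : (2 <= n)%N -> no_isolated (complete_graph n).
Proof. by case: n => [|[|n]] // _ v; rewrite deg_complete. Qed.

Definition arc n (g : sgraph n) : Type := {p : 'I_n * 'I_n | g p.1 p.2}.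

(* Matrices over the arcs are indexed by 'I_(narcs g), through enum_val. *)
Definition narcs n (g : sgraph n) : nat := #|{: arc g}|.

Definition arc_tail n (g : sgraph n) (i : 'I_(narcs g)) : 'I_n :=
  (val (enum_val i)).1.

Definition arc_head n (g : sgraph n) (i : 'I_(narcs g)) : 'I_n :=
  (val (enum_val i)).2.

Section Walk.
Variables (R : realType) (n : nat) (g : sgraph n).

Definition tail_mx : 'M[R]_(narcs g, n) :=
  \matrix_(a, v) if v == arc_tail a then (Num.sqrt (deg g v)%:R)^-1 else 0.

Definition reversal_mx : 'M[R]_(narcs g) :=
  \matrix_(a, b)
    ((arc_tail a == arc_head b) && (arc_head a == arc_tail b))%:R.

Definition transition_mx : 'M[R]_(narcs g) :=
  reversal_mx *m (2%:R *: (tail_mx *m tail_mx^T) - 1%:M).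

Definition walk_mx (t : nat) : 'M[R]_n :=
  tail_mx^T *m transition_mx ^+ t *m tail_mx.

Definition adj_mx : 'M[R]_n := \matrix_(u, v) (g u v)%:R.

Definition deg_invsqrt_mx : 'M[R]_n :=
  diag_mx (\row_v (Num.sqrt (deg g v)%:R)^-1).

Definition nadj_mx : 'M[R]_n := deg_invsqrt_mx *m adj_mx *m deg_invsqrt_mx.

End Walk.

Arguments tail_mx R {n} g.
Arguments reversal_mx R {n} g.
Arguments transition_mx R {n} g.
Arguments walk_mx R {n} g t.
Arguments adj_mx R {n} g.
Arguments deg_invsqrt_mx R {n} g.
Arguments nadj_mx R {n} g.

(* Orthogonal projection onto the row space of W (eigenspaces are row spaces
   in mxalgebra; for a symmetric matrix, rows and columns agree).
   kermx W^T spans the orthogonal complement of the row space of W. *)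
Definition orth_proj (R : realType) n (W : 'M[R]_n) : 'M[R]_n :=
  proj_mx W (kermx W^T).

Definition eigenproj (R : realType) n (B : 'M[R]_n) (theta : R) : 'M[R]_n :=
  orth_proj (eigenspace B theta).

Definition eigenvalues (R : realType) n (B : 'M[R]_n) : set R :=
  [set theta | eigenvalue B theta].

Section Transfer.
Variables (R : realType) (n : nat) (g : sgraph n).

Definition peak_state_transfer (u v : 'I_n) (t : nat) : Prop :=
  let B := nadj_mx R g in
  [/\ u != v, (0 < t)%N,
      `|walk_mx R g t u v| =
        \sum_(theta \in eigenvalues B) `|eigenproj B theta u v|
    & exists2 theta, theta \in eigenvalues B & eigenproj B theta u v != 0].

(* N e_v, cast to complex entries since the phase gamma below is complex *)
Definition vertex_state (v : 'I_n) : 'cV[R[i]]_(narcs g) :=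
  map_mx (real_complex R) (tail_mx R g) *m delta_mx v 0.

(* U^t N e_u *)
Definition evolved_state (t : nat) (u : 'I_n) : 'cV[R[i]]_(narcs g) :=
  map_mx (real_complex R) (transition_mx R g) ^+ t *m vertex_state u.

Definition perfect_state_transfer (u v : 'I_n) (t : nat) : Prop :=
  u != v /\
  exists2 gamma : R[i], `|gamma| = 1 &
    evolved_state t u = gamma *: vertex_state v.

Definition returns_at (u : 'I_n) (t : nat) : Prop :=
  (0 < t)%N /\
  exists2 gamma : R[i], `|gamma| = 1 &
    evolved_state t u = gamma *: vertex_state u.

Definition periodic_at (u : 'I_n) : Prop := exists t, returns_at u t.

Definition t_periodic_at (t : nat) (u : 'I_n) : Prop :=
  returns_at u t /\ forall s, returns_at u s -> (t <= s)%N.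

End Transfer.

Arguments peak_state_transfer R {n} g u v t.
Arguments perfect_state_transfer R {n} g u v t.
Arguments returns_at R {n} g u t.
Arguments periodic_at R {n} g u.
Arguments t_periodic_at R {n} g t u.

Section Sanity.
Variable R : realType.

(* A \sum_(i \in A) is 0 by convention when its support is infinite; this
   cannot happen for a sum over eigenvalues. *)
Lemma finite_eigenvalues n (B : 'M[R]_n) : finite_set (eigenvalues B).
Proof.
have cp0 : char_poly B != 0 by rewrite monic_neq0 // char_poly_monic.
apply: (@sub_finite_set _ _ [set` rootsR (char_poly B)]); last exact: finite_seq.
by move=> x; rewrite /eigenvalues /= eigenvalue_root_char -roots_on_rootsR.
Qed.

Lemma row_dot_eq0 n (x : 'rV[R]_n) : x *m x^T = 0 -> x = 0.
Proof.
move=> /matrixP/(_ 0 0); rewrite !mxE => /eqP; rewrite psumr_eq0; last first.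
  by move=> i _; rewrite mxE -expr2 sqr_ge0.
move=> /allP h; apply/rowP => i; rewrite mxE; apply/eqP.
by have := h i (mem_index_enum _); rewrite mxE -expr2 sqrf_eq0.
Qed.

Lemma orth_compl0 n (W : 'M[R]_n) : (W :&: kermx W^T)%MS = 0.
Proof.
apply/eqP/rowV0P => x; rewrite sub_capmx => /andP[/submxP[y xE] /sub_kermxP xW0].
by apply: row_dot_eq0; rewrite {2}xE trmx_mul mulmxA xW0 mul0mx.
Qed.

Lemma orth_full n (W : 'M[R]_n) (x : 'rV[R]_n) : (x <= W + kermx W^T)%MS.
Proof.
apply: submx_full; rewrite /row_full; apply/eqP.
rewrite -[LHS]addn0 -[X in (_ + X)%N](mxrank0 R n n) -(orth_compl0 W).
by rewrite mxrank_sum_cap mxrank_ker mxrank_tr subnKC // rank_leq_row.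
Qed.

Lemma orth_proj_idem n (W : 'M[R]_n) : orth_proj W *m orth_proj W = orth_proj W.
Proof. exact: proj_mx_proj (orth_compl0 W). Qed.

Lemma orth_proj_eqmx n (W : 'M[R]_n) : (orth_proj W :=: W)%MS.
Proof.
apply/eqmxP/andP; split.
  by rewrite -[X in (X <= _)%MS]mul1mx; exact: proj_mx_sub.
by apply/submxP; exists W; rewrite /orth_proj proj_mx_id // orth_compl0.
Qed.

Lemma orth_proj_sym n (W : 'M[R]_n) : (orth_proj W)^T = orth_proj W.
Proof.
set P := orth_proj W.
suff h : (1%:M - P) *m P^T = 0.
  have e : P^T = P *m P^T.
    by apply/eqP; rewrite -subr_eq0 -{1}[P^T]mul1mx -mulmxBl h.
  have := congr1 trmx e; rewrite (trmx_mul P) !trmxK => e'.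
  by rewrite e -e'.
have /submxP[Y PE] : (P <= W)%MS by rewrite orth_proj_eqmx.
rewrite PE (trmx_mul Y) mulmxA -PE.
suff -> : (1%:M - P) *m W^T = 0 by rewrite mul0mx.
apply/sub_kermxP; rewrite -[X in _ - X]mul1mx; apply: proj_mx_compl_sub.
by apply/row_subP => i; exact: orth_full.
Qed.

Lemma sum_arcs n (g : sgraph n) (F : 'I_n -> 'I_n -> R) :
  \sum_(a < narcs g) F (arc_tail a) (arc_head a) =
  \sum_u \sum_(v | g u v) F u v.
Proof.
rewrite pair_big_dep /=.
rewrite -(big_enum_val (fun a : arc g => F (val a).1 (val a).2)) /=.
rewrite (reindex_omap (val : arc g -> _) insub) /=; last first.
  by move=> p gp; rewrite insubT.
by apply: eq_bigl => a; rewrite valK eqxx (valP a).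
Qed.

Lemma tail_mxTK n (g : sgraph n) :
  no_isolated g -> (tail_mx R g)^T *m tail_mx R g = 1%:M.
Proof.
move=> gd; apply/matrixP => u v; rewrite !mxE.
pose s w : R := (Num.sqrt (deg g w)%:R)^-1.
transitivity (\sum_w \sum_(x | g w x)
    ((if u == w then s u else 0) * (if v == w then s v else 0))).
  rewrite -(sum_arcs g (fun w _ => _)).
  by apply: eq_bigr => a _; rewrite !mxE.
rewrite (bigD1 u) //= eqxx [X in _ + X]big1 ?addr0; last first.
  by move=> w wu; apply: big1 => x _; rewrite ifN_eqC ?mul0r.
rewrite sumr_const; case: eqVneq => [->|vu]; last first.
  by rewrite mulr0 mul0rn.
rewrite -mulr_natr -expr2 exprVn sqr_sqrtr ?ler0n //.
rewrite (_ : #|_| = deg g u) ?mulVf ?pnatr_eq0 -?lt0n ?gd //.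
by rewrite /deg cardsE; apply: eq_card => x.
Qed.

Lemma walk_mx1 n (g : sgraph n) : no_isolated g -> walk_mx R g 1 = nadj_mx R g.
Proof.
move=> gd; rewrite /walk_mx /transition_mx expr1.
set N := tail_mx R g; set S := reversal_mx R g.
have -> : N^T *m (S *m (2%:R *: (N *m N^T) - 1%:M)) *m N = N^T *m S *m N.
  rewrite -!mulmxA mulmxBl mul1mx -scalemxAl -mulmxA tail_mxTK // mulmx1.
  by rewrite scaler_nat mulr2n addrK.
apply/matrixP => u v; rewrite /nadj_mx -[in RHS]mulmxA mul_diag_mx mul_mx_diag !mxE.
pose s w : R := (Num.sqrt (deg g w)%:R)^-1.
transitivity (\sum_x \sum_(y | g x y)
   (if u == y then s u else 0) * (if v == x then s v else 0)).
  rewrite -(sum_arcs g (fun x y => _ * _)); apply: eq_bigr => b _.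
  rewrite !mxE; congr (_ * _).
  transitivity (\sum_x \sum_(y | g x y) (if u == x then s u else 0) *
     ((x == arc_head b) && (y == arc_tail b))%:R).
    rewrite -(sum_arcs g (fun x y => _ * _)); apply: eq_bigr => a _.
    by rewrite !mxE.
  rewrite (bigD1 (arc_head b)) //= [X in _ + X]big1 ?addr0; last first.
    by move=> x /negPf xb; apply: big1 => y _; rewrite xb mulr0.
  rewrite (bigD1 (arc_tail b)) /=; last by rewrite adj_sym; exact: (valP (enum_val b)).
  rewrite !eqxx mulr1 big1 ?addr0 // => y /andP[_ /negPf ->].
  by rewrite mulr0.
rewrite (bigD1 v) //= eqxx [X in _ + X]big1 ?addr0; last first.
  by move=> x xv; apply: big1 => y _; rewrite (ifN_eqC _ _ xv) mulr0.
rewrite -big_distrl /= -big_mkcondr /= mulrA; congr (_ * _).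
rewrite (adj_sym g u v); case: (boolP (g v u)) => guv; last first.
  rewrite mulr0 big1 // => y /andP[gvy /eqP uy].
  by rewrite uy gvy in guv.
rewrite mulr1 (bigD1 u) ?guv ?eqxx //= big1 ?addr0 // => y /andP[/andP[_ /eqP ->]].
by rewrite eqxx.
Qed.

End Sanity.

(* Main.v *)
Require Import Defs.
From mathcomp Require Import all_boot all_order all_algebra.
From mathcomp Require Import classical_sets fsbigop reals.
From mathcomp Require Import complex ring lra.

Set Implicit Arguments.
Unset Strict Implicit.
Unset Printing Implicit Defensive.

Import Order.TTheory GRing.Theory Num.Theory.
Local Open Scope ring_scope.

(** Write N, S, U, B for the tail, reversal, transition and normalized adjacency
    matrices. Since N^T N = 1 and S S = 1, the matrices U^t N obey the three-term
    recurrence U^(t+2) N = 2 U^(t+1) N B - U^t N ([evolved_rec]), hence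
    N^T U^t N = T_t(B) with T_t the Chebyshev polynomial of the first kind.

    For K_n, B = J' + x (1 - J') where J' = J / n is the projection onto the
    constant vectors and x = -1/(n-1). So N^T U^t N = J' + T_t(x) (1 - J')
    ([walk_complete]), with off-diagonal entries (1 - T_t(x)) / n, while the
    spectral idempotents of B are J' and 1 - J', whose off-diagonal absolute
    values sum to 2 / n. Peak state transfer at time t therefore forces
    |1 - T_t(x)| = 2, i.e. T_t(x) is -1 or 3 ([complete_peak]), and a return to a
    vertex at time t forces T_t(x) = 1 ([complete_returns]).

    These are excluded for n > 3 because 2 T_t(y/2), for t > 0, is a monic integer
    polynomial in y: its value at y = -2/(n-1), a rational which is not an
    integer, is not an integer ([cheb_notint]). For n = 3, x = -1/2 and T_t(x)
    is 1 if 3 divides t and -1/2 otherwise, which excludes peak state transfer and shows that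
    return times are multiples of 3. The actual returns of K_2 and K_3, and the
    perfect state transfer in K_2, follow from the recurrence and the value of
    B^2. *)

(** * Chebyshev polynomials *)

(** Value at [x] of the Chebyshev polynomial of the first kind T_t. *)
Fixpoint cheb (K : pzRingType) (x : K) (t : nat) : K :=
  match t with
  | 0 => 1
  | t1.+1 => if t1 is t2.+1 then 2%:R * x * cheb x t1 - cheb x t2 else x
  end.

Lemma chebSS (K : pzRingType) (x : K) t :
  cheb x t.+2 = 2%:R * x * cheb x t.+1 - cheb x t.
Proof. by []. Qed.

(** Up to the factor b^t, 2 T_t(a / (2 b)) is an integer congruent to a^t
    modulo b. *)
Lemma cheb_congr (K : comPzRingType) (a b : int) (x : K) :
  b%:~R * (2%:R * x) = a%:~R -> forall t, exists r : int,
  b%:~R ^+ t.+1 * (2%:R * cheb x t.+1) = (a ^+ t.+1 + b * r)%:~R.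
Proof.
move=> bx t.
suff [[r h] _] : (exists r : int,
    b%:~R ^+ t.+1 * (2%:R * cheb x t.+1) = (a ^+ t.+1 + b * r)%:~R) /\
  (exists r : int,
    b%:~R ^+ t.+2 * (2%:R * cheb x t.+2) = (a ^+ t.+2 + b * r)%:~R).
  by exists r.
elim: t => [|t [[r hr] [s hs]]].
  split; first by exists 0; rewrite !expr1 mulr0 addr0.
  exists (- (2 * b)); rewrite chebSS /=.
  transitivity ((b%:~R * (2%:R * x)) ^+ 2 - 2%:R * b%:~R ^+ 2); first by ring.
  by rewrite bx; ring.
split; first by exists s.
exists (a * s - b * (a ^+ t.+1 + b * r)); rewrite (chebSS _ t.+1).
transitivity ((b%:~R * (2%:R * x)) * (b%:~R ^+ t.+2 * (2%:R * cheb x t.+2))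
   - b%:~R ^+ 2 * (b%:~R ^+ t.+1 * (2%:R * cheb x t.+1))).
  by rewrite !exprS; ring.
by rewrite hr hs bx !exprS; ring.
Qed.

(** The numbers 2 T_t(y / 2) are the values at [y] of monic integer polynomials,
    so none of them with t > 0 is an integer at a rational [y] that is not. *)
Lemma cheb_notint (K : numDomainType) (a b : int) (x : K) t (k : int) :
  coprimez b a -> (1 < `|b|)%N -> b%:~R * (2%:R * x) = a%:~R -> (0 < t)%N ->
  2%:R * cheb x t <> k%:~R.
Proof.
case: t => // t cab b1 bx _ ck; have [r] := cheb_congr bx t.
rewrite ck -rmorphXn -rmorphM /= => /intr_inj h.
have : (b %| a ^+ t.+1 * 1)%Z.
  rewrite mulr1 (_ : a ^+ t.+1 = b * (b ^+ t * k - r)) ?dvdz_mulr //.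
  by rewrite mulrBr mulrA -exprS h addrK.
rewrite Gauss_dvdzr ?coprimezXr // dvdz1 => /eqP b1'.
by rewrite b1' in b1.
Qed.

Lemma cheb_half_period (K : numFieldType) (x : K) t :
  2%:R * x = - 1 -> cheb x t.+3 = cheb x t.
Proof. by move=> hx; rewrite (chebSS _ t.+1) chebSS hx; ring. Qed.

Lemma cheb_half (K : numFieldType) (x : K) t :
  2%:R * x = - 1 -> cheb x t = if (t %% 3 == 0)%N then 1 else x.
Proof.
move=> hx; have [m] := ubnP t; elim: m t => // m IH [|[|[|t]]] //.
  move=> _; rewrite chebSS hx /=; transitivity (x + (-1 - 2%:R * x)); first by ring.
  by rewrite hx subrr addr0.
move=> ht; rewrite cheb_half_period // -[in RHS]addn3 modnDr; apply: IH.
by rewrite ltnS in ht; exact: ltnW (ltnW ht).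
Qed.

(** * The arc-reversal walk on a graph *)

Section Walk.
Variables (R : realType) (n : nat) (g : sgraph n).
Local Notation N := (tail_mx R g).
Local Notation S := (reversal_mx R g).
Local Notation U := (transition_mx R g).
Local Notation B := (nadj_mx R g).

Lemma arc_adj (a : 'I_(narcs g)) : g (arc_head a) (arc_tail a).
Proof. by rewrite adj_sym; exact: (valP (enum_val a)). Qed.

(** The arc [a] reversed. *)
Definition rev_arc (a : 'I_(narcs g)) : 'I_(narcs g) :=
  enum_rank (exist (fun p : 'I_n * 'I_n => g p.1 p.2)
               (arc_head a, arc_tail a) (arc_adj a) : Defs.arc g).

Lemma arc_tail_rev a : arc_tail (rev_arc a) = arc_head a.
Proof. by rewrite /arc_tail /rev_arc enum_rankK. Qed.

Lemma arc_head_rev a : arc_head (rev_arc a) = arc_tail a.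
Proof. by rewrite /arc_head /rev_arc enum_rankK. Qed.

Lemma arc_inj (a b : 'I_(narcs g)) :
  arc_tail a = arc_tail b -> arc_head a = arc_head b -> a = b.
Proof.
move=> ht hh; apply: enum_val_inj; apply: val_inj.
by rewrite [LHS]surjective_pairing [RHS]surjective_pairing; congr (_, _).
Qed.

Lemma reversal_mxE a b : S a b = (b == rev_arc a)%:R.
Proof.
rewrite mxE; congr (nat_of_bool _)%:R; apply/andP/eqP => [[/eqP h1 /eqP h2]|->].
  by apply: arc_inj; rewrite ?arc_tail_rev ?arc_head_rev.
by rewrite arc_tail_rev arc_head_rev !eqxx.
Qed.

Lemma mul_reversal_mxE p (M : 'M[R]_(narcs g, p)) a j :
  (S *m M) a j = M (rev_arc a) j.
Proof.
rewrite mxE (bigD1 (rev_arc a)) //= reversal_mxE eqxx mul1r big1 ?addr0 //.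
by move=> b /negPf ba; rewrite reversal_mxE ba mul0r.
Qed.

Lemma reversal_mxK : S *m S = 1%:M.
Proof.
apply/matrixP => a b; rewrite mul_reversal_mxE reversal_mxE mxE eq_sym.
congr (nat_of_bool (_ == _))%:R.
by apply: arc_inj; rewrite ?arc_tail_rev ?arc_head_rev ?arc_tail_rev.
Qed.

Hypothesis gd : no_isolated g.

Lemma transition_mx_tail : U *m N = S *m N.
Proof.
rewrite /transition_mx -mulmxA mulmxBl mul1mx -scalemxAl -mulmxA tail_mxTK //.
by rewrite mulmx1 scaler_nat mulr2n addrK.
Qed.

Lemma tail_reversal_tail : N^T *m S *m N = B.
Proof.
by rewrite -walk_mx1 // /walk_mx expr1 -[RHS]mulmxA transition_mx_tail mulmxA.
Qed.

(** The three-term recurrence of the walk, which is that of the Chebyshev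
    polynomials: on the space spanned by the columns of [N] and [S *m N] the
    walk is a product of two involutions. *)
Lemma evolved_rec t :
  U ^+ t.+2 *m N = 2%:R *: (U ^+ t.+1 *m N *m B) - U ^+ t *m N.
Proof.
have UX s p (M : 'M_(_, p)) : U ^+ s.+1 *m M = U ^+ s *m (U *m M).
  by rewrite exprSr [RHS]mulmxA.
have USN : U *m (S *m N) = 2%:R *: (U *m N *m B) - N.
  rewrite transition_mx_tail -tail_reversal_tail /transition_mx -mulmxA.
  rewrite mulmxBl mul1mx mulmxBr -scalemxAl -scalemxAr !mulmxA.
  by rewrite reversal_mxK mul1mx.
rewrite UX transition_mx_tail UX USN mulmxBr -scalemxAr UX.
by rewrite [U ^+ t *m (U *m N *m B)]mulmxA.
Qed.

Lemma walk_mx0 : walk_mx R g 0 = 1%:M.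
Proof. by rewrite /walk_mx expr0 mulmx1 tail_mxTK. Qed.

Lemma walk_mx_rec t :
  walk_mx R g t.+2 = 2%:R *: (walk_mx R g t.+1 *m B) - walk_mx R g t.
Proof.
by rewrite /walk_mx -mulmxA evolved_rec mulmxBr -scalemxAr !mulmxA.
Qed.

Lemma evolved_stateE t (u : 'I_n) :
  evolved_state R g t u = map_mx (real_complex R) (U ^+ t *m N *m delta_mx u 0).
Proof.
rewrite /evolved_state /vertex_state; move: U => W.
by rewrite !map_mxM rmorphXn /= map_delta_mx mulmxA.
Qed.

Lemma vertex_stateE (u : 'I_n) :
  vertex_state R g u = map_mx (real_complex R) (N *m delta_mx u 0).
Proof. by rewrite /vertex_state map_mxM /= map_delta_mx. Qed.

Lemma returns_walk_mx0 (u v : 'I_n) t :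
  returns_at R g u t -> v != u -> walk_mx R g t v u = 0.
Proof.
case=> _ [gamma _]; rewrite evolved_stateE vertex_stateE => h vu.
have := congr1 (mulmx (map_mx (real_complex R) N^T)) h.
rewrite -scalemxAr -!map_mxM !mulmxA tail_mxTK // mul1mx => /matrixP/(_ v 0).
rewrite -/(walk_mx R g t) -colE !mxE (negPf vu) /= mulr0.
by move/eqP; rewrite fmorph_eq0 => /eqP.
Qed.

Lemma returnsP (u : 'I_n) t : (0 < t)%N -> U ^+ t *m N = N -> returns_at R g u t.
Proof.
move=> t0 h; split=> //; exists 1; first by rewrite normr1.
by rewrite evolved_stateE vertex_stateE h scale1r.
Qed.

End Walk.

(** * Orthogonal projections onto eigenspaces *)

(** [orth_proj W] is the only symmetric idempotent with the row space of [W]. *)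
Lemma orth_proj_uniq (R : realType) n (W P : 'M[R]_n) :
  P^T = P -> P *m P = P -> (P :=: W)%MS -> orth_proj W = P.
Proof.
move=> Ps Pi PW.
have PQ : P *m orth_proj W = P by rewrite /orth_proj proj_mx_id ?orth_compl0 ?PW.
have /submxP[Y QE] : (orth_proj W <= P)%MS by rewrite orth_proj_eqmx PW.
have QP : orth_proj W *m P = orth_proj W by rewrite QE -mulmxA Pi.
by rewrite -QP -{2}Ps -{2}PQ trmx_mul orth_proj_sym Ps.
Qed.

Lemma eigenvalue_of_proj (R : realType) n (M : 'M[R]_n) c :
  eigenproj M c != 0 -> eigenvalue M c.
Proof.
by apply: contraNN => /eqP h; rewrite -submx0 /eigenproj orth_proj_eqmx h.
Qed.

(** For an idempotent [e] and scalars [a] and [b], the spectral theory of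
    [a *: e + b *: (1%:M - e)]. *)
Section TwoEigenvalues.
Variables (F : fieldType) (n : nat) (e : 'M[F]_n) (a b : F).
Hypotheses (ei : e *m e = e) (ab : a != b).
Let M := a *: e + b *: (1%:M - e).

Lemma idem_compl : (1%:M - e) *m (1%:M - e) = 1%:M - e.
Proof. by rewrite mulmxBl mul1mx mulmxBr mulmx1 ei subrr subr0. Qed.

Lemma idem_combM c d :
  (e + c *: (1%:M - e)) *m (e + d *: (1%:M - e)) = e + (c * d) *: (1%:M - e).
Proof.
rewrite mulmxDl !mulmxDr -!scalemxAl -!scalemxAr idem_compl ei.
rewrite mulmxBr mulmxBl mul1mx mulmx1 ei subrr !scaler0 add0r addr0.
by rewrite scalerA.
Qed.

Lemma eigenspace_idem : (e :=: eigenspace M a)%MS.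
Proof.
apply/eqmxP/andP; split.
  apply/eigenspaceP; rewrite /M mulmxDr -!scalemxAr mulmxBr mulmx1 ei subrr.
  by rewrite scaler0 addr0.
have : (eigenspace M a *m M == a *: eigenspace M a).
  by apply/eqP/eigenspaceP.
set W := eigenspace M a => /eqP.
rewrite /M mulmxDr -!scalemxAr mulmxBr mulmx1 => h.
apply/submxP; exists W; apply/eqP; rewrite -subr_eq0.
have : (a - b) *: (W - W *m e) = 0.
  rewrite scalerBl [a *: (W - _)]scalerBr -h scalerBr.
  by rewrite [X in X - _ - _]addrC addrK subrr.
by move/eqP; rewrite scaler_eq0 [a - b == 0]subr_eq0 (negPf ab).
Qed.

Lemma eigenvalue_idem c : eigenvalue M c -> c = a \/ c = b.
Proof.
case/eigenvalueP => v; rewrite /M mulmxDr -!scalemxAr mulmxBr mulmx1 => h v0.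
have [->|ca] := eqVneq c a; [by left|right].
have h1 : a *: (v *m e) = c *: (v *m e).
  have := congr1 (mulmx^~ e) h.
  by rewrite /= mulmxDl -!scalemxAl mulmxBl -!mulmxA ei subrr scaler0 addr0.
have ve : v *m e = 0.
  apply/eqP; have /eqP : (c - a) *: (v *m e) = 0 by rewrite scalerBl h1 subrr.
  by rewrite scaler_eq0 [c - a == 0]subr_eq0 (negPf ca).
move: h; rewrite ve scaler0 add0r subr0 => h.
have /eqP : (c - b) *: v = 0 by rewrite scalerBl h subrr.
by rewrite scaler_eq0 (negPf v0) orbF subr_eq0 => /eqP.
Qed.

End TwoEigenvalues.

(** * Complete graphs *)

Section Complete.
Variables (R : realType) (n : nat).
Hypothesis n2 : (2 <= n)%N.
Local Notation K := (complete_graph n).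

(* The eigenvalue of the normalized adjacency matrix other than 1. *)
Let x : R := - (n.-1%:R)^-1.
(* The projection onto the constant vectors. *)
Let e : 'M[R]_n := const_mx (n%:R^-1).

Let n0 : n%:R != 0 :> R.
Proof. by rewrite pnatr_eq0 -lt0n ltnW. Qed.

Let m0 : n.-1%:R != 0 :> R.
Proof. by rewrite pnatr_eq0 -lt0n; case: n n2 => [|[]]. Qed.

Let nm : n%:R = n.-1%:R + 1 :> R.
Proof. by rewrite natr1 prednK // ltnW. Qed.

Lemma const_idem : e *m e = e.
Proof.
apply/matrixP => i j; rewrite !mxE (eq_bigr (fun=> n%:R^-1 * n%:R^-1)).
  by rewrite sumr_const card_ord -[LHS]mulr_natr -mulrA mulVf ?mulr1.
by move=> k _; rewrite !mxE.
Qed.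

Lemma nadj_completeE i j : nadj_mx R K i j = (i != j)%:R / n.-1%:R.
Proof.
rewrite /nadj_mx -mulmxA mul_diag_mx mul_mx_diag !mxE !deg_complete /= mulrCA.
by rewrite -expr2 exprVn sqr_sqrtr ?ler0n.
Qed.

Lemma nadj_complete : nadj_mx R K = e + x *: (1%:M - e).
Proof.
apply/matrixP => i j; rewrite nadj_completeE !mxE /x.
have m1 := m0; have n1 := n0; rewrite nm in n1 *.
by case: eqVneq => _ /=; field; rewrite ?m1 ?n1.
Qed.

Lemma nadj_complete2 :
  nadj_mx R K *m nadj_mx R K = e + (x * x) *: (1%:M - e).
Proof. by rewrite nadj_complete idem_combM // const_idem. Qed.

Lemma walk_complete t : walk_mx R K t = e + cheb x t *: (1%:M - e).
Proof.
have gd := no_isolated_complete n2.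
suff [] : walk_mx R K t = e + cheb x t *: (1%:M - e) /\
  walk_mx R K t.+1 = e + cheb x t.+1 *: (1%:M - e) by [].
elim: t => [|t [h1 h2]].
  by rewrite walk_mx0 // walk_mx1 // nadj_complete scale1r addrC subrK.
split=> //; rewrite walk_mx_rec // h1 h2 nadj_complete chebSS.
rewrite idem_combM ?const_idem //.
by apply/matrixP => i j; rewrite !mxE; ring.
Qed.

Lemma walk_complete_off t (u v : 'I_n) : u != v ->
  walk_mx R K t u v = (1 - cheb x t) / n%:R.
Proof.
by move=> uv; rewrite walk_complete !mxE (negPf uv) /=; field.
Qed.

Let x_neq1 : 1 != x.
Proof.
rewrite gt_eqF // /x (@lt_trans _ _ 0) // oppr_lt0 invr_gt0 ltr0n.
by case: n n2 => [|[]].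
Qed.

Lemma complete_eigenproj1 : eigenproj (nadj_mx R K) 1 = e.
Proof.
rewrite nadj_complete -{1}[e]scale1r; apply: orth_proj_uniq.
- by apply/matrixP => i j; rewrite !mxE.
- exact: const_idem.
- by apply: eigenspace_idem; [exact: const_idem|].
Qed.

Lemma complete_eigenproj2 : eigenproj (nadj_mx R K) x = 1%:M - e.
Proof.
have ci := idem_compl const_idem.
have -> : nadj_mx R K = x *: (1%:M - e) + 1 *: (1%:M - (1%:M - e)).
  by rewrite nadj_complete subKr addrC scale1r.
apply: orth_proj_uniq => //.
- by apply/matrixP => i j; rewrite !mxE eq_sym.
- by apply: eigenspace_idem => //; rewrite eq_sym.
Qed.

Lemma complete_eigenvalues :
  eigenvalues (nadj_mx R K) = [set 1; x]%classic.
Proof.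
apply/seteqP; split=> c /=.
  rewrite /eigenvalues /= nadj_complete -{1}[e]scale1r.
  by move=> /(eigenvalue_idem const_idem).
have h (M : 'M[R]_n) i j : M i j != 0 -> M != 0.
  by apply: contraNN => /eqP ->; rewrite mxE.
have i0 : 'I_n := Ordinal (ltnW n2).
case=> ->; apply: eigenvalue_of_proj.
  by rewrite complete_eigenproj1; apply: (h _ i0 i0); rewrite mxE invr_eq0.
rewrite complete_eigenproj2; apply: (h _ (Ordinal (ltnW n2)) (Ordinal n2)).
by rewrite !mxE /= sub0r oppr_eq0 invr_eq0.
Qed.

Lemma complete_peak_sum (u v : 'I_n) : u != v ->
  (\sum_(c \in eigenvalues (nadj_mx R K)) `|eigenproj (nadj_mx R K) c u v|)%R
    = 2%:R / n%:R.
Proof.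
move=> uv; rewrite complete_eigenvalues fsbigU0 ?fsbig_set1 //=; last first.
  by move=> c [-> h]; move: x_neq1; rewrite h eqxx.
rewrite complete_eigenproj1 complete_eigenproj2 !mxE (negPf uv) sub0r normrN.
by rewrite ger0_norm ?invr_ge0 //; ring.
Qed.

(** The value 3 is out of the range of T_t on [-1, 1], but like -1 it has an
    integer double, so for n > 3 the arithmetic of [cheb_notint] excludes both
    at once. *)
Lemma complete_peak (u v : 'I_n) t : peak_state_transfer R K u v t ->
  [/\ (0 < t)%N & cheb x t = -1 \/ cheb x t = 3%:R].
Proof.
case=> uv t0; rewrite complete_peak_sum // walk_complete_off // => h _.
split=> //; move: h; rewrite normrM normfV normr_nat.
move/(mulIf (invr_neq0 n0)).
by have [h0 h|h0 h] := ler0P (1 - cheb x t); [right|left]; lra.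
Qed.

(** A state proportional to that of [u] is orthogonal to the state of any other
    vertex, so an off-diagonal entry of the walk matrix vanishes. *)
Lemma complete_returns (u : 'I_n) t : returns_at R K u t -> cheb x t = 1.
Proof.
move=> h; have [v vu] : exists v, v != u.
  case: (eqVneq u (Ordinal (ltnW n2))) => [->|]; first by exists (Ordinal n2).
  by rewrite eq_sym; exists (Ordinal (ltnW n2)).
have := returns_walk_mx0 (no_isolated_complete n2) h vu.
rewrite walk_complete_off // => /eqP.
by rewrite mulf_eq0 invr_eq0 (negPf n0) orbF subr_eq0 => /eqP.
Qed.

(** In lowest terms 2 x is -2 / (n - 1) for n even, -1 / ((n - 1) / 2) for n odd. *)
Lemma complete_notint t (k : int) : (3 < n)%N -> (0 < t)%N ->
  2%:R * cheb x t <> k%:~R.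
Proof.
move=> n3 t0; have xm : n.-1%:R * x = -1 by rewrite /x mulrN mulfV.
have [m_odd|m_even] := boolP (odd n.-1).
  apply: (@cheb_notint _ (-2) n.-1) => //.
  - by rewrite /coprimez /= gcdzN; rewrite -coprimen2 in m_odd.
  - by case: n n3 => [|[|[]]].
  - by rewrite -pmulrn mulrCA xm mulrN1.
have mE : n.-1 = (n.-1./2 * 2)%N by rewrite muln2 even_halfK.
apply: (@cheb_notint _ (-1) n.-1./2) => //.
- by rewrite /coprimez gcdzN gcdz1.
- by rewrite /= -(ltn_pmul2r (isT : 0 < 2)%N) -mE; case: n n3 => [|[|[|[]]]].
- by rewrite -pmulrn mulrA -natrM -mE xm.
Qed.

Let c : R := (Num.sqrt n.-1%:R)^-1.

Lemma complete_tail_mulE p (M : 'M[R]_(n, p)) a j :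
  (tail_mx R K *m M) a j = c * M (arc_tail a) j.
Proof.
rewrite mxE (bigD1 (arc_tail a)) //= mxE eqxx deg_complete big1 ?addr0 //.
by move=> v /negPf va; rewrite mxE va mul0r.
Qed.

Lemma complete_reversal_mulE p (M : 'M[R]_(n, p)) a j :
  (reversal_mx R K *m tail_mx R K *m M) a j = c * M (arc_head a) j.
Proof. by rewrite -mulmxA mul_reversal_mxE complete_tail_mulE arc_tail_rev. Qed.

End Complete.

(** * The graphs K_2 and K_3 *)

Lemma K2_reversal (R : realType) :
  let K := complete_graph 2 in
  reversal_mx R K *m tail_mx R K = tail_mx R K *m nadj_mx R K.
Proof.
move=> K; rewrite -[LHS]mulmx1; apply/matrixP => a v.
rewrite complete_tail_mulE complete_reversal_mulE nadj_completeE divr1 mxE.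
congr (_ * (nat_of_bool _)%:R).
have := arc_adj a; rewrite /=.
by case: (arc_head a) (arc_tail a) v => [[|[|]]] // ? [[|[|]]] // ? [[|[|]]].
Qed.

Lemma K2_perfect (R : realType) (u v : 'I_2) : u != v ->
  perfect_state_transfer R (complete_graph 2) u v 1.
Proof.
(* Once U *m N = N *m B, it remains that B exchanges the two vertices. *)
move=> uv; split=> //; exists 1; first by rewrite normr1.
rewrite evolved_stateE vertex_stateE scale1r expr1.
rewrite transition_mx_tail ?K2_reversal; last exact: no_isolated_complete.
congr map_mx; rewrite -mulmxA; congr mulmx.
rewrite -colE; apply/matrixP => i j.
rewrite mxE nadj_completeE // divr1 !mxE ord1 andbT; congr (nat_of_bool _)%:R.
by case: u v i uv => [[|[|]]] // ? [[|[|]]] // ? [[|[|]]].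
Qed.

Lemma K2_period (R : realType) :
  let K := complete_graph 2 in
  transition_mx R K ^+ 2 *m tail_mx R K = tail_mx R K.
Proof.
have gd := no_isolated_complete (isT : (1 < 2)%N).
rewrite /= evolved_rec // expr1 expr0 mul1mx transition_mx_tail // K2_reversal.
have BB : nadj_mx R (complete_graph 2) *m nadj_mx R (complete_graph 2) = 1%:M.
  by rewrite nadj_complete2 //= invr1 mulrNN mulr1 scale1r addrC subrK.
by rewrite -mulmxA BB mulmx1 scaler_nat mulr2n addrK.
Qed.

Lemma K3_period (R : realType) :
  let K := complete_graph 3 in
  transition_mx R K ^+ 3 *m tail_mx R K = tail_mx R K.
Proof.
set K := complete_graph 3; set N := tail_mx R K; set B := nadj_mx R K => /=.
have gd : no_isolated K by exact: no_isolated_complete.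
rewrite !evolved_rec // expr1 expr0 mul1mx transition_mx_tail //.
set M := reversal_mx R K *m N.
have -> : 2%:R *: ((2%:R *: (M *m B) - N) *m B) - M =
    4%:R *: (M *m (B *m B)) - 2%:R *: (N *m B) - M *m 1%:M.
  by rewrite mulmxBl -scalemxAl scalerBr scalerA -natrM mulmxA mulmx1.
(* Every term is N or S *m N times a 3 x 3 matrix, so the entry at an arc only
   involves the rows of these matrices at its head and tail. *)
rewrite -[RHS]mulmx1; apply/matrixP => a v.
have entryE (P Q T : 'M[R]_(narcs K, 3)) : (4%:R *: P - 2%:R *: Q - T) a v =
    4%:R * P a v - 2%:R * Q a v - T a v by rewrite !mxE.
rewrite entryE !complete_tail_mulE !complete_reversal_mulE nadj_complete2 //.
rewrite nadj_completeE // !mxE -!(eq_sym v) /=.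
set c := _^-1.
by case: (v == arc_tail a); case: (v == arc_head a) => /=; field.
Qed.

Theorem lemma4p1 (R : realType) :
  (forall n : nat, (2 <= n)%N ->
     ((2 < n)%N -> forall (u v : 'I_n) (t : nat),
        ~ peak_state_transfer R (complete_graph n) u v t) /\
     ((3 < n)%N -> forall u : 'I_n, ~ periodic_at R (complete_graph n) u)) /\
  (forall u v : 'I_2, u != v ->
     perfect_state_transfer R (complete_graph 2) u v 1) /\
  (forall u : 'I_2, t_periodic_at R (complete_graph 2) 2 u) /\
  (forall u : 'I_3, t_periodic_at R (complete_graph 3) 3 u).
Proof.
have half : 2%:R * - (2%:R)^-1 = -1 :> R by rewrite mulrN mulfV ?pnatr_eq0.
split=> [n n2|].
  split=> [n2' u v t /(complete_peak n2) [t0]|n3 u [t ht]].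
    have [n3|] := boolP (3 < n)%N.
      have h k := complete_notint (R := R) n2 (k := k) n3 t0.
      case=> c; first by apply: (h (-2)); rewrite c; ring.
      by apply: (h 6); rewrite c; ring.
    rewrite -leqNgt => n3; have -> : n = 3 by apply/eqP; rewrite eqn_leq n3.
    by rewrite cheb_half //=; case: ifP => _ []; lra.
  apply: (complete_notint (R := R) n2 (k := 2) n3 (proj1 ht)).
  by rewrite (complete_returns n2 ht); ring.
split; first exact: K2_perfect.
split=> u.
  split=> [|[|[|s]] h //]; first by apply: returnsP => //; exact: K2_period.
    by case: h.
  (* T_1(-1) = -1 rules out a return at time 1. *)
  by have /= := complete_returns (isT : 2 <= 2)%N h; lra.
split=> [|s h]; first by apply: returnsP => //; exact: K3_period.
have := complete_returns (isT : 2 <= 3)%N h; rewrite cheb_half //=.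
case: ifP => [s3 _|_]; last by lra.
by apply: dvdn_leq; [case: h|].
Qed.
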